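(* Let $X$ be a Banach space and let $T\in L(X)$ be such that $T^{\dag}$ exists. Then the following statements are equivalent: (i) $T$ is EP. (ii) Both of the following hold: (a) there exist Banach spaces $X_1$ and $X_2$, an injective $A_1\in L(X_1)$, $B_1\in L(X_1)$, $V_1,W_1\in L(X_1\oplus_1X_2,X)$ with $V_1$ injective, and $S_1\in L(X,X_1\oplus_1X_2)$ such that $T=V_1(A_1\oplus 0)S_1$ and $T^{\dag}=W_1(B_1\oplus 0)S_1$; (b) there exist Banach spaces $X_3$ and $X_4$, $A_2\in L(X_3)$, an injective $B_2\in L(X_3)$, $V_2,W_2\in L(X_3\oplus_1X_4,X)$ with $W_2$ injective, and $S_2\in L(X,X_3\oplus_1X_4)$ such that $T=V_2(A_2\oplus 0)S_2$ and $T^{\dag}=W_2(B_2\oplus 0)S_2$. (iii) Both of the following hold: (a) there exist Banach spaces $Y_1$ and $Y_2$, a surjective $A_3\in L(Y_1)$, $B_3\in L(Y_1)$, $V_3\in L(Y_1\oplus_1Y_2,X)$ and $S_3,S_4\in L(X,Y_1\oplus_1Y_2)$ with $S_3$ surjective, such that $T=V_3(A_3\oplus 0)S_3$ and $T^{\dag}=V_3(B_3\oplus 0)S_4$; (b) there exist Banach spaces $Y_3$ and $Y_4$, $A_4\in L(Y_3)$, a surjective $B_4\in L(Y_3)$, $V_4\in L(Y_3\oplus_1Y_4,X)$ and $S_5,S_6\in L(X,Y_3\oplus_1Y_4)$ with $S_6$ surjective, such that $T=V_4(A_4\oplus 0)S_5$ and $T^{\dag}=V_4(B_4\oplus 0)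S_6$.
   Context: Banach spaces are complex; $L(X,Y)$ is the space of bounded linear maps $X\to Y$, $L(X)=L(X,X)$. $X_1\oplus_1X_2$ is the direct sum with norm $\|x_1\oplus x_2\|=\|x_1\|+\|x_2\|$, and for $S\in L(X_1)$, $S\oplus 0\in L(X_1\oplus_1X_2)$ is the map $x_1\oplus x_2\mapsto Sx_1\oplus 0$. An operator $S\in L(X)$ is hermitian if $\|\exp(itS)\|=1$ for all $t\in\mathbb{R}$. The Moore-Penrose inverse of $T\in L(X)$, if it exists, is the (unique) $S\in L(X)$ with $T=TST$, $S=STS$ and $TS$, $ST$ hermitian; it is denoted $T^{\dag}$. $T$ is EP if $T^{\dag}$ exists and $TT^{\dag}=T^{\dag}T$. *)

(* Defs.v *)
From HB Require Import structures.
From mathcomp Require Import all_boot all_order all_algebra.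
From mathcomp Require Import boolp classical_sets functions reals.
From mathcomp Require Import topology normedtype sequences.
From mathcomp Require Import complex.

Set Implicit Arguments.
Unset Strict Implicit.
Unset Printing Implicit Defensive.

Import Order.TTheory GRing.Theory Num.Theory.
Import numFieldNormedType.Exports.

Local Open Scope classical_set_scope.
Local Open Scope ring_scope.
Local Open Scope complex_scope.

(* X1 * X2 with the norm |x1| + |x2|; the library's product X1 * X2 carries
   the max norm instead, hence the alias *)
Definition l1sum (X1 X2 : Type) : Type := (X1 * X2)%type.

Notation "X1 \oplus1 X2" := (l1sum X1 X2)
  (at level 50, left associativity) : type_scope.

Section L1Sum.
Context {K : numFieldType}.

HB.instance Definition _ (X1 X2 : lmodType K) :=
  GRing.Lmodule.copy (X1 \oplus1 X2) (X1 * X2)%type.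

Section Normed.
Variables X1 X2 : normedModType K.

Definition l1norm (x : X1 \oplus1 X2) : K := `|x.1| + `|x.2|.

Let l1norm_triangle x y : l1norm (x + y) <= l1norm x + l1norm y.
Proof. by rewrite /l1norm addrACA lerD// ler_normD. Qed.

Let l1normZ (a : K) x : l1norm (a *: x) = `|a| * l1norm x.
Proof. by rewrite /l1norm /= !normrZ mulrDr. Qed.

Let l1norm0_eq0 x : l1norm x = 0 -> x = 0.
Proof.
case: x => x1 x2 /eqP; rewrite /l1norm paddr_eq0//= !normr_eq0.
by move=> /andP[/eqP-> /eqP->].
Qed.

HB.instance Definition _ := Lmodule_isNormed.Build K (X1 \oplus1 X2)
  l1norm_triangle l1normZ l1norm0_eq0.

Lemma l1normE (x : X1 \oplus1 X2) : `|x| = `|x.1| + `|x.2|.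
Proof. by []. Qed.

End Normed.

Section Complete.
Variables X1 X2 : completeNormedModType K.

Let l1sum_complete (F : set_system (X1 \oplus1 X2)) :
  ProperFilter F -> cauchy F -> cvg F.
Proof.
move=> FF Fc.
have cvg_proj (Y : completeNormedModType K) (p : X1 \oplus1 X2 -> Y) :
    (forall x y, `|p x - p y| <= `|x - y|) -> cvg (p @ F).
  move=> plip; apply/cauchy_cvgP/cauchyP => e e0.
  have /cauchyP/(_ e e0)[x Fx] := Fc.
  exists (p x); apply: (@filterS _ F _ _ _ _ Fx) => y.
  by rewrite /= -!ball_normE; exact/le_lt_trans/plip.
have c1 : cvg ((fst : X1 \oplus1 X2 -> X1) @ F).
  by apply: cvg_proj => x y; rewrite l1normE lerDl.
have c2 : cvg ((snd : X1 \oplus1 X2 -> X2) @ F).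
  by apply: cvg_proj => x y; rewrite l1normE lerDr.
set l1 := lim ((fst : X1 \oplus1 X2 -> X1) @ F) in c1 *.
set l2 := lim ((snd : X1 \oplus1 X2 -> X2) @ F) in c2 *.
apply/cvg_ex; exists ((l1, l2) : X1 \oplus1 X2).
apply/fcvgrPdist_lt => e e0.
have e20 : 0 < e / 2 by rewrite divr_gt0.
have /cvgrPdist_lt/(_ _ e20) F1 := c1.
have /cvgrPdist_lt/(_ _ e20) F2 := c2.
apply: filterS2 F1 F2 => x x1 x2.
by rewrite [ltRHS]splitr l1normE ltrD.
Qed.

HB.instance Definition _ :=
  Uniform_isComplete.Build (X1 \oplus1 X2) l1sum_complete.

End Complete.
End L1Sum.

Section BoundedOperator.
Context {R : realType}.
Local Notation C := R[i].

Section Def.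
Variables X Y : normedModType C.

Definition blin : {pred X -> Y} := [pred f : X -> Y |
  `[< linear f /\ exists M : C, forall x, `|f x| <= M * `|x| >]].

Record bop := BOp { bop_fun :> X -> Y; _ : bop_fun \in blin }.

HB.instance Definition _ := [isSub for bop_fun].
HB.instance Definition _ := [Choice of bop by <:].

Let blin_submod : submod_closed blin.
Proof.
split.
  apply/asboolP; split; first by move=> a x y; rewrite scaler0 addr0.
  by exists 0 => x; rewrite normr0 mul0r.
move=> a f g /asboolP[fl [M fM]] /asboolP[gl [N gN]]; apply/asboolP; split.
  move=> b x y; rewrite !fctE fl gl !scalerDr !scalerA (mulrC a b) -!scalerA.
  by rewrite addrACA.
exists (`|a| * M + N) => x; rewrite !fctE (le_trans (ler_normD _ _))//.
by rewrite mulrDl lerD// normrZ -mulrA ler_wpM2l.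
Qed.
HB.instance Definition _ := GRing.isSubmodClosed.Build C (X -> Y) blin blin_submod.
HB.instance Definition _ := [SubChoice_isSubLmodule of bop by <:].

Lemma bop_linear (f : bop) : linear f.
Proof. by case: f => f /= /asboolP[]. Qed.

HB.instance Definition _ (f : bop) :=
  GRing.isLinear.Build C X Y *:%R (bop_fun f) (bop_linear f).

Lemma bopP (f g : bop) : (forall x, f x = g x) <-> f = g.
Proof.
by split=> [fg|->//]; apply: val_inj; apply/funext.
Qed.

Lemma bop_bounded (f : bop) : exists M : C, forall x, `|f x| <= M * `|x|.
Proof. by case: f => f /= /asboolP[]. Qed.

(* as the norm of a normedModType over R[i] takes its values in R[i], the
   supremum is computed in R and injected back *)
Definition opnorm (f : bop) : C :=
  (sup [set complex.Re `|f x| | x in [set x : X | `|x| <= 1]])%:C.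

Let opnorm_set (f : bop) := [set complex.Re `|f x| | x in [set x : X | `|x| <= 1]].

Let opnorm_set0 f : opnorm_set f !=set0.
Proof. by exists (complex.Re `|f 0|), 0 => //=; rewrite normr0 ler01. Qed.

Let ReK (x : C) : 0 <= x -> (complex.Re x)%:C = x.
Proof. by move=> x0; rewrite RRe_real// ger0_real. Qed.

Let opnorm_has_ub f : has_ubound (opnorm_set f).
Proof.
have [M fM] := bop_bounded f; exists (complex.Re `|M|) => _ [x/= x1 <-].
rewrite -lecR !ReK//.
rewrite (le_trans (fM x))//.
have : 0 <= M * `|x| by exact: le_trans (fM x).
by move=> /ger0_norm <-; rewrite normrM normr_id ler_piMr.
Qed.

Let opnormR_ge0 f : 0 <= sup (opnorm_set f).
Proof.
apply: (ub_le_sup (opnorm_has_ub f)); exists 0 => /=.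
  by rewrite normr0 ler01.
by rewrite linear0 normr0.
Qed.

Let opnorm_ge0 f : 0 <= opnorm f.
Proof. by rewrite (lecR 0) opnormR_ge0. Qed.

Lemma le_opnorm (f : bop) x : `|f x| <= opnorm f * `|x|.
Proof.
have [->|x0] := eqVneq x 0; first by rewrite linear0 !normr0 mulr0.
rewrite -ler_pdivrMr ?normr_gt0// mulrC.
have -> : `|x|^-1 * `|f x| = `|f (`|x|^-1 *: x)|.
  by rewrite linearZ /= normrZ ger0_norm// invr_ge0.
rewrite -[leLHS]ReK// lecR; apply: (ub_le_sup (opnorm_has_ub f)).
exists (`|x|^-1 *: x) => //=.
by rewrite normrZ ger0_norm ?invr_ge0// mulVf ?normr_eq0.
Qed.

Lemma opnorm_le (f : bop) (M : C) : 0 <= M -> (forall x, `|f x| <= M * `|x|) ->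
  opnorm f <= M.
Proof.
move=> M0 fM; rewrite -[leRHS]ReK// lecR; apply: ge_sup; first exact: opnorm_set0.
move=> _ [x/= x1 <-].
by rewrite -lecR !ReK// (le_trans (fM x))// ler_piMr.
Qed.

Let opnorm_triangle f g : opnorm (f + g) <= opnorm f + opnorm g.
Proof.
apply: opnorm_le => [|x]; first by rewrite addr_ge0.
by rewrite mulrDl (le_trans (ler_normD _ _))// lerD// le_opnorm.
Qed.

Let opnormZ_le (a : C) f : opnorm (a *: f) <= `|a| * opnorm f.
Proof.
apply: opnorm_le => [|x]; first by rewrite mulr_ge0.
by rewrite -mulrA [leLHS]normrZ ler_wpM2l// le_opnorm.
Qed.

Let opnorm0_eq0 f : opnorm f = 0 -> f = 0.
Proof.
move=> f0; apply/bopP => x; apply/eqP; rewrite -normr_le0.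
by rewrite (le_trans (le_opnorm f x))// f0 mul0r.
Qed.

Let opnormZ (a : C) f : opnorm (a *: f) = `|a| * opnorm f.
Proof.
apply/le_anti; rewrite opnormZ_le/=.
have [->|a0] := eqVneq a 0; first by rewrite normr0 mul0r.
rewrite -ler_pdivlMl ?normr_gt0// -normfV (le_trans _ (opnormZ_le _ _))//.
by rewrite scalerA mulVf// scale1r.
Qed.

HB.instance Definition _ := Lmodule_isNormed.Build C bop
  opnorm_triangle opnormZ opnorm0_eq0.

Lemma bop_normE (f : bop) :
  `|f| = (sup [set complex.Re `|f x| | x in [set x : X | `|x| <= 1]])%:C.
Proof. by []. Qed.

Lemma le_bop_norm (f : bop) x : `|f x| <= `|f| * `|x|.
Proof. exact: le_opnorm. Qed.

End Def.

Section Complete.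
Variables (X : normedModType C) (Y : completeNormedModType C).

Let bop_complete (F : set_system (bop X Y)) : ProperFilter F -> cauchy F -> cvg F.
Proof.
move=> FF Fc.
have near_ball e : 0 < e -> exists f, F [set g : bop X Y | `|f - g| < e].
  move=> e0; have /cauchyP/(_ e e0)[f Ff] := Fc.
  by exists f; rewrite -ball_normE in Ff.
have ev_lip (f g : bop X Y) x : `|f x - g x| <= `|f - g| * `|x|.
  exact: (le_opnorm (f - g)).
have ev_cvg x : cvg ((fun f : bop X Y => f x) @ F).
  apply/cauchy_cvgP/cauchyP => e e0.
  have x0 : 0 < `|x| + 1 by rewrite ltr_wpDl.
  have [|f Ff] := near_ball (e / (`|x| + 1)); first by rewrite divr_gt0.
  exists (f x); apply: (@filterS _ F _ _ _ _ Ff) => g /= fg.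
  rewrite -ball_normE /= (le_lt_trans (ev_lip _ _ _))//.
  rewrite ltr_pdivlMr// in fg; apply: le_lt_trans fg.
  by rewrite ler_wpM2l// lerDl.
pose h x := lim ((fun f : bop X Y => f x) @ F).
have h_lin : linear h.
  move=> a x y; apply: cvg_lim => //.
  have -> : (fun f : bop X Y => f (a *: x + y)) =
      (fun f : bop X Y => a *: f x + f y).
    by apply/funext => f; rewrite linearP.
  by apply: cvgD; [apply: cvgZl_tmp|]; exact: ev_cvg.
have h_near e f x : F [set g : bop X Y | `|f - g| < e] ->
    `|f x - h x| <= e * `|x|.
  move=> Ff; apply/ler_addgt0Pr => d d0.
  have /cvgrPdist_lt/(_ d d0) Fh := ev_cvg x.
  have [g [/= fg gh]] := filter_ex (filterI Ff Fh).
  rewrite -(subrK (g x) (f x)) -addrA (le_trans (ler_normD _ _))//.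
  apply: lerD; last by rewrite distrC ltW.
  by rewrite (le_trans (ev_lip _ _ _))// ler_wpM2r// ltW.
have h_blin : h \in @blin X Y.
  apply/asboolP; split=> //.
  have [f Ff] := near_ball 1 ltr01; exists (`|f| + 1) => x.
  rewrite -[h x](subKr (f x)) (le_trans (ler_normB _ _))// mulrDl.
  by apply: lerD; [exact: le_opnorm|exact: h_near].
apply/cvg_ex; exists (BOp h_blin).
apply/fcvgrPdist_lt => e e0.
have e30 : 0 < e / 2 / 2 by rewrite !divr_gt0.
have [f Ff] := near_ball _ e30; apply: (@filterS _ F _ _ _ _ Ff) => g /= fg.
rewrite -(subrK f (BOp h_blin)) -addrA (le_lt_trans (ler_normD _ _))//.
rewrite (splitr e) ler_ltD//; last by rewrite (lt_trans fg)// gtr_pMr ?divr_gt0// invf_lt1// ltr1n.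
apply: (@le_trans _ _ (e / 2 / 2)).
apply: opnorm_le => [|x]; first exact: ltW.
by rewrite distrC; exact: h_near.
by rewrite ler_piMr ?invf_le1 ?ler1n// divr_ge0// ltW.
Qed.

HB.instance Definition _ := Uniform_isComplete.Build (bop X Y) bop_complete.

End Complete.

Section Composition.
Variables X Y Z : normedModType C.

Let bcomp_blin (f : bop Y Z) (g : bop X Y) : f \o g \in @blin X Z.
Proof.
apply/asboolP; split; first by move=> a x y; rewrite /= !linearP.
exists (`|f| * `|g|) => x /=; rewrite (le_trans (le_bop_norm _ _))// -mulrA.
by rewrite ler_wpM2l// le_bop_norm.
Qed.

Definition bcomp f g : bop X Z := BOp (bcomp_blin f g).

End Composition.

Let bid_blin (X : normedModType C) : idfun \in @blin X X.
Proof.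
apply/asboolP; split; first by move=> a x y.
by exists 1 => x; rewrite mul1r.
Qed.

Definition bid (X : normedModType C) : bop X X := BOp (bid_blin X).

End BoundedOperator.

Notation "f \oL g" := (bcomp f g) (at level 50, left associativity) : ring_scope.

Section Hermitian.
Context {R : realType}.
Local Notation C := R[i].

Section Sum0.
Variables X1 X2 : normedModType C.

Let oplus0_blin (S : bop X1 X1) :
  (fun x : X1 \oplus1 X2 => (S x.1, 0) : X1 \oplus1 X2) \in
  @blin R (X1 \oplus1 X2) (X1 \oplus1 X2).
Proof.
apply/asboolP; split.
  by move=> a x y; congr pair; rewrite /= ?linearP// scaler0 addr0.
exists `|S| => x; rewrite !l1normE /= normr0 addr0 (le_trans (le_bop_norm _ _))//.
by rewrite ler_wpM2l// lerDl.
Qed.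

Definition oplus0 (S : bop X1 X1) : bop (X1 \oplus1 X2) (X1 \oplus1 X2) :=
  BOp (oplus0_blin S).

End Sum0.

Variable X : completeNormedModType C.
Implicit Types S T : bop X X.

Definition bpow S n : bop X X := iter n (bcomp S) (bid X).

Definition bexp S : bop X X :=
  limn (series (fun n => n`!%:R^-1 *: bpow S n) : (bop X X)^nat).

Definition hermitian S := forall t : R, `|bexp ((t *i)%C *: S)| = 1.

Definition moore_penrose T S :=
  [/\ T = T \oL S \oL T, S = S \oL T \oL S,
      hermitian (T \oL S) & hermitian (S \oL T)].

Definition EP T := exists2 S, moore_penrose T S & T \oL S = S \oL T.

End Hermitian.

(* Main.v *)
(* A hermitian idempotent P satisfies |I - 2P| = |exp(i pi P)| = 1.  If
   idempotents P and Q have the same kernel, then N = P - Q squares to zero and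
   (I - 2P)(I - 2Q) = I + 2N; if the factors are contractions, then so is every
   power I + 2nN, whence N = 0.  Passing to I - P and I - Q, the same holds for
   idempotents with the same range.  Applied to TT^+ and T^+T, this says that T
   is EP as soon as T and T^+ have the same kernel, or the same range, and these
   equalities can be read off from the factorizations in (ii) and (iii).
   Conversely, if P = TT^+ = T^+T, then A = T + (I - P) is invertible, with
   inverse T^+ + (I - P), and T = AP = PA; hence one can take X_1 = Y_1 = X and
   X_2 = Y_2 = 0. *)
Require Import Defs.
From HB Require Import structures.
From mathcomp Require Import all_boot all_order all_algebra.
From mathcomp Require Import boolp classical_sets functions reals.
From mathcomp Require Import topology normedtype sequences trigo.
From mathcomp Require Import complex.

Set Implicit Arguments.
Unset Strict Implicit.
Unset Printing Implicit Defensive.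

Import Order.TTheory GRing.Theory Num.Theory.
Import numFieldNormedType.Exports.

Local Open Scope classical_set_scope.
Local Open Scope ring_scope.

(** * The scalar series for exp(i pi) *)

Section ComplexExponential.
Variable R : realType.
Local Notation C := (R[i] : numFieldType).

Lemma cvg_real_complex (u : R^nat) (l : R) :
  u @ \oo --> l -> (fun n => (u n)%:C%C : C) @ \oo --> (l%:C%C : C).
Proof.
move=> /cvgrPdist_lt ul; apply/cvgrPdist_lt => e e0.
(* A positive element of [R[i]] is real, so the radius [e] comes from [R]. *)
have eE : (complex.Re e)%:C%C = e by rewrite RRe_real// gtr0_real.
have : 0 < complex.Re e by rewrite -ltcR eE.
move=> /ul; apply: filterS => n.
by rewrite -rmorphB normc_def expr0n addr0 sqrtr_sqr -eE ltcR.
Qed.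

(** [cos_coeff] vanishes at odd indices and [sin_coeff] at even ones, so the parity of [n] decides
    which summand on the right can survive. *)
Lemma euler_coeff (t : R) n :
  n`!%:R^-1 * ((t *i)%C : C) ^+ n =
  (cos_coeff t n)%:C%C + 'i%C * (sin_coeff t n)%:C%C.
Proof.
have -> : (t *i)%C = 'i%C * t%:C%C :> C by simpc.
have facC : (n`!%:R : C) = (n`!%:R : R)%:C%C by rewrite rmorph_nat.
have sgnC k : ((-1) ^+ k : C) = ((-1) ^+ k : R)%:C%C by rewrite rmorph_sign.
rewrite exprMn facC -(rmorphXn (real_complex R)) -(fmorphV (real_complex R)).
rewrite /cos_coeff /sin_coeff /= -exprnP.
have -> : ('i%C : C) ^+ n = if odd n then 'i%C * ((-1) ^+ n.-1./2 : R)%:C%C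
    else ((-1) ^+ n./2 : R)%:C%C.
  rewrite -!sgnC -{1}(odd_double_half n) exprD -mul2n exprM sqr_i.
  case: ifP => on; last by rewrite mul1r.
  rewrite expr1; congr (_ * _ ^+ _).
  by rewrite -[in RHS](odd_double_half n) on /= doubleK.
case: (odd n); rewrite /= !(mul0r, mul1r, rmorph0, rmorph1, add0r, addr0, mulr0).
  by rewrite mulrC -!mulrA -!(rmorphM (real_complex R)) /= mulrA.
by rewrite mulrC -!mulrA -!(rmorphM (real_complex R)) /= mulrA.
Qed.

Lemma cvg_expi_pi :
  series (fun n => n`!%:R^-1 * ((pi *i)%C : C) ^+ n) @ \oo --> (-1 : C).
Proof.
have -> : series (fun n => n`!%:R^-1 * ((pi *i)%C : C) ^+ n) =
    (fun n => (series (cos_coeff (pi : R)) n)%:C%C +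
              'i%C * (series (sin_coeff (pi : R)) n)%:C%C).
  apply/funext => n; rewrite /series /= !rmorph_sum mulr_sumr -big_split /=.
  by apply: eq_bigr => k _; rewrite euler_coeff.
have -> : (-1 : C) = (cos (pi : R))%:C%C + 'i%C * (sin (pi : R))%:C%C.
  by rewrite cospi sinpi rmorphN rmorph1 rmorph0 mulr0 addr0.
apply: cvgD.
  by apply: cvg_real_complex; rewrite unlock; exact: is_cvg_series_cos_coeff.
apply: cvgM; first exact: cvg_cst.
by apply: cvg_real_complex; rewrite unlock; exact: is_cvg_series_sin_coeff.
Qed.

End ComplexExponential.

(** * Hermitian idempotents, and when two of them coincide *)

Section HermitianIdempotent.
Variables (R : realType) (X : completeNormedModType R[i]).
Implicit Types P Q T : bop X X.

Lemma bcomp_norm_le (Y Z W : normedModType R[i]) (f : bop Z W) (g : bop Y Z) :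
  `|f \oL g| <= `|f| * `|g|.
Proof.
apply: opnorm_le => [|x]; first by rewrite mulr_ge0.
by rewrite (le_trans (le_bop_norm f (g x)))// -mulrA ler_wpM2l// le_bop_norm.
Qed.

Lemma bpow_idem P (c : R[i]) n : P \oL P = P ->
  bpow (c *: P) n.+1 = c ^+ n.+1 *: P.
Proof.
move=> PP; elim: n => [|n IH]; first by apply/bopP => x; rewrite expr1.
rewrite /bpow iterS -/(bpow _ _) IH; apply/bopP => x.
change (c *: P (c ^+ n.+1 *: P x) = c ^+ n.+2 *: P x).
have PPx : P (P x) = P x by move/bopP: PP => /(_ x).
by rewrite linearZ/= PPx scalerA -exprS.
Qed.

(** Every positive power of [P] is [P], so exp(cP) = I + (e^c - 1)P; [z] stands for e^c. *)
Lemma bexp_idem P (c z : (R[i] : numFieldType)) : P \oL P = P ->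
  series (fun n => n`!%:R^-1 * c ^+ n) @ \oo --> z ->
  bexp (c *: P) = bid X - P + z *: P.
Proof.
move=> PP cz; apply: cvg_lim => //.
(* The term of index 0 is [bid X], not a multiple of [P]; after the shift every partial sum contains
   it, and it can be split off. *)
rewrite -(cvg_shiftS _) /=.
have -> : (fun n => series (fun n => n`!%:R^-1 *: bpow (c *: P) n) n.+1) =
    (fun n => bid X - P + series (fun n => n`!%:R^-1 * c ^+ n) n.+1 *: P).
  apply/funext => n; rewrite /series /= !big_nat_recl// fact0 invr1 expr0 mulr1.
  rewrite scale1r scalerDl scale1r addrA subrK scaler_suml; congr (_ + _).
  by apply: eq_bigr => k _; rewrite bpow_idem// scalerA.
apply: cvgD; first exact: cvg_cst.
apply: cvgZr_tmp; rewrite (cvg_shiftS (series _)).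
exact: cz.
Qed.

Lemma hermitian_idem_norm P : P \oL P = P -> Defs.hermitian P ->
  `|bid X - 2 *: P| = 1.
Proof.
move=> PP /(_ pi); rewrite (bexp_idem PP (@cvg_expi_pi R)) scaleN1r.
by rewrite -addrA -opprD -[P in P + P]scale1r -scalerDl.
Qed.

(** Since N^2 = 0, (I + N)^n = I + nN. These powers are contractions, so n|N| <= 2 for every n,
    which forces N = 0. *)
Lemma sqr0_power_bounded0 (N : bop X X) : N \oL N = 0 -> `|bid X + N| <= 1 ->
  N = 0.
Proof.
move=> NN N1.
have bound n : `|bid X + n%:R *: N| <= 1.
  elim: n => [|n IH].
    rewrite scale0r addr0; apply: opnorm_le => // x.
    by rewrite mul1r.
  suff -> : bid X + n.+1%:R *: N = (bid X + n%:R *: N) \oL (bid X + N).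
    by rewrite (le_trans (bcomp_norm_le _ _))// mulr_ile1.
  apply/bopP => x.
  have NNx : N (N x) = 0 by have /bopP/(_ x) := NN.
  change (x + n.+1%:R *: N x = x + N x + n%:R *: N (x + N x)).
  rewrite [N (x + _)]linearD/= NNx addr0 -natr1 scalerDl scale1r -addrA.
  by rewrite [N x + _]addrC.
apply/eqP; rewrite -normr_le0; apply/negPn/negP => N0.
have Npos : 0 < `|N| by rewrite normr_gt0 -normr_eq0; apply: contra N0 => /eqP->.
have Nn n : n%:R * `|N| <= 2.
  have -> : n%:R * `|N| = `|(bid X + n%:R *: N) - (bid X + 0%:R *: N)|.
    by rewrite scale0r addr0 addrC addKr normrZ normr_nat.
  by rewrite (le_trans (ler_normB _ _))// -[2]/(1 + 1)%:R natrD lerD.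
(* The norm lies in [R[i]]; taking its real part carries the estimate over to the archimedean field
   [R]. *)
have NE : `|N| = (complex.Re `|N|)%:C%C by rewrite RRe_real// ger0_real.
move: Npos Nn; rewrite {}NE; set s := complex.Re _ => s0 sn.
have {}s0 : 0 < s by rewrite -ltcR.
have /archi_boundP : 0 <= 2 / s by rewrite divr_ge0// ltW.
rewrite ltr_pdivrMr// ltNge => /negP; apply.
by rewrite -lecR rmorphM !rmorph_nat; exact: sn.
Qed.

(** The last two premises encode equality of the kernels. They give (P - Q)^2 = 0 and (I - 2P)(I -
    2Q) = I + 2(P - Q), a product of contractions. *)
Lemma idem_ker_eq P Q : P \oL P = P -> Q \oL Q = Q ->
  `|bid X - 2 *: P| <= 1 -> `|bid X - 2 *: Q| <= 1 ->
  P \oL Q = P -> Q \oL P = Q -> P = Q.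
Proof.
move=> PP QQ P1 Q1 PQ QP.
have [Px Qx PQx QPx] : [/\ forall x, P (P x) = P x, forall x, Q (Q x) = Q x,
    forall x, P (Q x) = P x & forall x, Q (P x) = Q x].
  by split; [move/bopP: PP|move/bopP: QQ|move/bopP: PQ|move/bopP: QP].
have /sqr0_power_bounded0 : (2 *: (P - Q)) \oL (2 *: (P - Q)) = 0.
  apply/bopP => x.
  change (2 *: (P (2 *: (P x - Q x)) - Q (2 *: (P x - Q x))) = 0 :> X).
  rewrite [P (_ *: _)]linearZ [Q (_ *: _)]linearZ/= [P (_ - _)]linearB [Q (_ - _)]linearB/=.
  by rewrite Px Qx PQx QPx !subrr scaler0.
have -> : bid X + 2 *: (P - Q) = (bid X - 2 *: P) \oL (bid X - 2 *: Q).
  apply/bopP => x.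
  change (x + 2 *: (P x - Q x) = x - 2 *: Q x - 2 *: P (x - 2 *: Q x)).
  have -> : P (x - 2 *: Q x) = - P x.
    by rewrite linearB linearZ/= PQx scaler_nat mulr2n opprD addrA subrr add0r.
  by rewrite scalerN opprK scalerBr addrA addrAC.
rewrite (le_trans (bcomp_norm_le _ _)) ?mulr_ile1//.
by move=> /(_ isT)/eqP; rewrite scaler_eq0 pnatr_eq0/= subr_eq0 => /eqP.
Qed.

(** The complements I - P and I - Q have the same kernel, and I - 2(I - P) = -(I - 2P) has the same
    norm as I - 2P. *)
Lemma idem_range_eq P Q : P \oL P = P -> Q \oL Q = Q ->
  `|bid X - 2 *: P| <= 1 -> `|bid X - 2 *: Q| <= 1 ->
  P \oL Q = Q -> Q \oL P = P -> P = Q.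
Proof.
move=> PP QQ P1 Q1 PQ QP.
have [Px Qx PQx QPx] : [/\ forall x, P (P x) = P x, forall x, Q (Q x) = Q x,
    forall x, P (Q x) = Q x & forall x, Q (P x) = P x].
  by split; [move/bopP: PP|move/bopP: QQ|move/bopP: PQ|move/bopP: QP].
have complE S : bid X - 2 *: (bid X - S) = - (bid X - 2 *: S).
  apply/bopP => x; change (x - 2 *: (x - S x) = - (x - 2 *: S x)).
  rewrite scalerBr !opprB addrC -addrA; congr (_ + _).
  by rewrite scaler_nat mulr2n opprD subrK.
have compl S1 S2 x : (bid X - S1) ((bid X - S2) x) = x - S2 x - S1 x + S1 (S2 x).
  change (x - S2 x - S1 (x - S2 x) = x - S2 x - S1 x + S1 (S2 x)).
  by rewrite linearB opprB addrA addrAC.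
suff /eqP : bid X - P = bid X - Q by rewrite (inj_eq (addrI _)) eqr_opp => /eqP.
by apply: idem_ker_eq; rewrite ?complE ?normrN//; apply/bopP => x;
  rewrite [LHS]compl ?Px ?Qx ?PQx ?QPx ?subrK// addrAC subrK.
Qed.

Section Hermitian.
Variables P Q : bop X X.
Hypotheses (PP : P \oL P = P) (QQ : Q \oL Q = Q).
Hypotheses (hP : Defs.hermitian P) (hQ : Defs.hermitian Q).

Lemma hermitian_idem_ker_eq :
  (forall x, P x = 0 <-> Q x = 0) -> P = Q.
Proof.
move=> PQ; have [Px Qx] : (forall x, P (P x) = P x) /\ (forall x, Q (Q x) = Q x).
  by split; [move/bopP: PP|move/bopP: QQ].
apply: idem_ker_eq => //; rewrite ?hermitian_idem_norm//; apply/bopP => x.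
(* [x - Q x] lies in the kernel of [Q], hence in that of [P], which gives PQ = P. *)
- have /PQ : Q (x - Q x) = 0 by rewrite linearB/= Qx subrr.
  by rewrite linearB => /subr0_eq.
- have /PQ : P (x - P x) = 0 by rewrite linearB/= Px subrr.
  by rewrite linearB => /subr0_eq.
Qed.

Lemma hermitian_idem_range_eq : range P = range Q -> P = Q.
Proof.
move=> PQ; have [Px Qx] : (forall x, P (P x) = P x) /\ (forall x, Q (Q x) = Q x).
  by split; [move/bopP: PP|move/bopP: QQ].
apply: idem_range_eq => //; rewrite ?hermitian_idem_norm//; apply/bopP => x.
- have [y _ yx] : range P (Q x) by rewrite PQ; exists x.
  by rewrite /= -yx Px.
- have [y _ yx] : range Q (P x) by rewrite -PQ; exists x.
  by rewrite /= -yx Qx.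
Qed.

End Hermitian.

(** * Moore-Penrose inverses: uniqueness and criteria for EP *)

Section MoorePenrose.

Lemma moore_penrose_proj T S : moore_penrose T S ->
  (T \oL S) \oL (T \oL S) = T \oL S /\ (S \oL T) \oL (S \oL T) = S \oL T.
Proof.
case=> TST STS _ _; have [Tx Sx] : (forall x, T x = T (S (T x))) /\
    (forall x, S x = S (T (S x))).
  by split; [move/bopP: TST|move/bopP: STS].
by split; apply/bopP => x /=; rewrite -?Tx -?Sx.
Qed.

Lemma moore_penrose_ker T S x : moore_penrose T S -> (S \oL T) x = 0 <-> T x = 0.
Proof.
case=> /bopP TST _ _ _; split => /= [Sx0|->]; last by rewrite linear0.
by rewrite TST /= Sx0 linear0.
Qed.

Lemma moore_penrose_range T S : moore_penrose T S -> range (T \oL S) = range T.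
Proof.
case=> /bopP TST _ _ _; apply/seteqP; split => _ [x _ <-]; first by exists (S x).
by exists (T x) => //; rewrite [RHS]TST.
Qed.

Lemma moore_penrose_sym T S : moore_penrose T S -> moore_penrose S T.
Proof. by case. Qed.

(** TS and TS' both have the range of T, ST and S'T both have its kernel, so TS = TS' and ST = S'T.
    Hence S = STS = S'TS = S'TS' = S'. *)
Lemma moore_penrose_uniq T S S' :
  moore_penrose T S -> moore_penrose T S' -> S = S'.
Proof.
move=> TS TS'; have [TSi STi] := moore_penrose_proj TS.
have [TSi' STi'] := moore_penrose_proj TS'.
have [_ STS h1 h2] := TS; have [_ STS' h1' h2'] := TS'.
have /bopP E1 : T \oL S = T \oL S'.
  apply: hermitian_idem_range_eq => //.
  by rewrite (moore_penrose_range TS) (moore_penrose_range TS').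
have /bopP E2 : S \oL T = S' \oL T.
  apply: hermitian_idem_ker_eq => // x.
  by rewrite (moore_penrose_ker x TS) (moore_penrose_ker x TS').
rewrite STS STS'; apply/bopP => x /=.
by rewrite [LHS]E2 /=; congr (S' _); exact: E1.
Qed.

Variables (T Td : bop X X).
Hypothesis TTd : moore_penrose T Td.

(** [EP] quantifies over the inverse; uniqueness identifies it with [Td]. *)
Lemma EP_commute : EP T <-> T \oL Td = Td \oL T.
Proof.
by split=> [[S /(moore_penrose_uniq TTd) <-]//|]; exists Td.
Qed.

(** The product [Td \oL T] has the kernel of [T] and, by symmetry, [T \oL Td] has that of [Td]. *)
Lemma EP_ker : (forall x, T x = 0 <-> Td x = 0) -> EP T.
Proof.
move=> TTd0; apply/EP_commute; have [i1 i2] := moore_penrose_proj TTd.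
have [_ _ h1 h2] := TTd; apply: hermitian_idem_ker_eq => // x.
rewrite (moore_penrose_ker x TTd) TTd0.
exact: (moore_penrose_ker x (moore_penrose_sym TTd)).
Qed.

Lemma EP_range : range T = range Td -> EP T.
Proof.
move=> TTd0; apply/EP_commute; have [i1 i2] := moore_penrose_proj TTd.
have [_ _ h1 h2] := TTd; apply: hermitian_idem_range_eq => //.
by rewrite (moore_penrose_range TTd) TTd0
  (moore_penrose_range (moore_penrose_sym TTd)).
Qed.

End MoorePenrose.

End HermitianIdempotent.

(** * The zero Banach space *)

Section ZeroSpace.
Variable R : realType.

(** Serves as the second summand when a commuting pair is factored. *)
Definition zero_space := 'rV[R[i]]_0.

HB.instance Definition _ := NormedModule.on zero_space.

Let zero_space_complete (F : set_system zero_space) :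
  ProperFilter F -> cauchy F -> cvg F.
Proof.
move=> FF _; apply/cvg_ex; exists 0 => A /nbhs_singleton A0.
by apply: filterS filterT => x _; rewrite (thinmx0 x).
Qed.

HB.instance Definition _ := Uniform_isComplete.Build zero_space zero_space_complete.

End ZeroSpace.

Section L1Maps.
Variables (R : realType) (X Z : normedModType R[i]).

Let l1fst_blin : (fst : X \oplus1 Z -> X) \in @blin R (X \oplus1 Z) X.
Proof.
by apply/asboolP; split=> //; exists 1 => x; rewrite mul1r l1normE lerDl.
Qed.

Definition l1fst : bop (X \oplus1 Z) X := BOp l1fst_blin.

Let l1inl_blin : (fun x => (x, 0) : X \oplus1 Z) \in @blin R X (X \oplus1 Z).
Proof.
apply/asboolP; split; first by move=> a x y; congr pair; rewrite /= scaler0 addr0.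
by exists 1 => x; rewrite mul1r l1normE /= normr0 addr0.
Qed.

Definition l1inl : bop X (X \oplus1 Z) := BOp l1inl_blin.

End L1Maps.

(** * What the factorizations imply, and their construction for a commuting pair *)

Section Factorization.
Variables (R : realType) (X : completeNormedModType R[i]).
Implicit Types T Td : bop X X.

(** If [T x = 0], injectivity of [V] and [A] makes the first component of [S x] vanish, and
    [oplus0 X2 B] depends on that component only. *)
Lemma injective_factor_ker (X1 X2 : normedModType R[i]) (A B : bop X1 X1)
    (V W : bop (X1 \oplus1 X2) X) (S : bop X (X1 \oplus1 X2)) T Td :
  injective A -> injective V ->
  T = V \oL oplus0 X2 A \oL S -> Td = W \oL oplus0 X2 B \oL S ->
  forall x, T x = 0 -> Td x = 0.
Proof.
move=> Ai Vi -> -> x /= /eqP; rewrite -(linear0 V) (inj_eq Vi).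
move=> /eqP[/eqP]; rewrite -(linear0 A) (inj_eq Ai) => /eqP ->.
rewrite (_ : (_, _) = 0 :> X1 \oplus1 X2) ?linear0//.
Qed.

(** Solve [A y = B (S' x).1], then [S z = (y, 0)]; as the left factor [V] is shared,
    [T z = Td x]. *)
Lemma surjective_factor_range (Y1 Y2 : normedModType R[i]) (A B : bop Y1 Y1)
    (V : bop (Y1 \oplus1 Y2) X) (S S' : bop X (Y1 \oplus1 Y2)) T Td :
  set_surj setT setT A -> set_surj setT setT S ->
  T = V \oL oplus0 Y2 A \oL S -> Td = V \oL oplus0 Y2 B \oL S' ->
  range Td `<=` range T.
Proof.
move=> As Ss -> -> _ [x _ <-].
have [y _ yE] := As (B (S' x).1) I; have [z _ zE] := Ss (y, 0) I.
by exists z => //=; rewrite zE /= yE.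
Qed.

Section Commuting.
Variables T Td : bop X X.
Hypotheses (TTd : moore_penrose T Td) (TTdC : T \oL Td = Td \oL T).

Let Z := zero_space R.

(** Acts as [T] on the range of the idempotent P = [T \oL Td] and as the identity on its kernel. *)
Let A := T + (bid X - (T \oL Td)).

Let TTdCx x : T (Td x) = Td (T x). Proof. by move/bopP: TTdC => /(_ x). Qed.

Let TTdTx x : T (Td (T x)) = T x.
Proof. by case: TTd => /bopP/(_ x) /= <-. Qed.

Let TdTTdx x : Td (T (Td x)) = Td x.
Proof. by case: TTd => _ /bopP/(_ x) /= <-. Qed.

Let AE x : A x = T x + (x - T (Td x)). Proof. by []. Qed.

Let A_proj x : A (T (Td x)) = T x.
Proof. by rewrite AE !TTdTx subrr addr0 TTdCx TTdTx. Qed.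

Let proj_A x : T (Td (A x)) = T x.
Proof.
rewrite AE -[LHS]/((T \oL Td) _) linearD linearB /=.
by rewrite TTdTx TdTTdx subrr addr0.
Qed.

Let A_inv x : Td (A x) + (A x - T (Td (A x))) = x.
Proof.
have TdA : Td (A x) = T (Td x).
  by rewrite -TdTTdx proj_A TTdCx.
by rewrite proj_A TdA AE addrAC addrN add0r addrC subrK.
Qed.

Let inv_A x : A (Td x + (x - T (Td x))) = x.
Proof.
have Tu : T (Td x + (x - T (Td x))) = T (Td x).
  by rewrite linearD linearB/= TTdCx TTdTx subrr addr0.
have Tdu : T (Td (Td x + (x - T (Td x)))) = Td x.
  rewrite -[LHS]/((T \oL Td) _) linearD linearB/=.
  by rewrite TTdTx subrr addr0 TTdCx TdTTdx.
by rewrite AE Tu Tdu addrAC subrr add0r addrC subrK.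
Qed.

(** T = AP and Td = Td P have P on the right, so P goes into the shared [S1]; [V1] is the projection
    onto [X], injective because the other summand is zero. *)
Lemma commuting_injective_factor :
  exists (X1 X2 : completeNormedModType R[i]) (A1 B1 : bop X1 X1)
    (V1 W1 : bop (X1 \oplus1 X2) X) (S1 : bop X (X1 \oplus1 X2)),
  [/\ injective A1, injective V1,
      T = V1 \oL oplus0 X2 A1 \oL S1 & Td = W1 \oL oplus0 X2 B1 \oL S1].
Proof.
exists X, Z, A, Td, (l1fst X Z), (l1fst X Z), (l1inl X Z \oL (T \oL Td)).
split.
- exact: (can_inj (g := fun y => Td y + (y - T (Td y))) A_inv).
- by move=> [x z] [y w] /= ->; rewrite [z]thinmx0 [w]thinmx0.
- by apply/bopP => x; exact: esym (A_proj x).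
- by apply/bopP => x; exact: esym (TdTTdx x).
Qed.

(** Here P goes to the left, into the shared [V1]: T = PA and Td = P Td. The inclusion of [X] is
    onto because the other summand is zero. *)
Lemma commuting_surjective_factor :
  exists (Y1 Y2 : completeNormedModType R[i]) (A1 B1 : bop Y1 Y1)
    (V1 : bop (Y1 \oplus1 Y2) X) (S1 S2 : bop X (Y1 \oplus1 Y2)),
  [/\ set_surj setT setT A1, set_surj setT setT S1,
      T = V1 \oL oplus0 Y2 A1 \oL S1 & Td = V1 \oL oplus0 Y2 B1 \oL S2].
Proof.
exists X, Z, A, Td, (T \oL Td \oL l1fst X Z), (l1inl X Z), (l1inl X Z).
split.
- by move=> x _; exists (Td x + (x - T (Td x))).
- by move=> [x z] _; exists x => //; rewrite [z]thinmx0.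
- by apply/bopP => x; exact: esym (proj_A x).
- by apply/bopP => x /=; rewrite TTdCx TdTTdx.
Qed.

End Commuting.

End Factorization.

Theorem theorem5p5 (R : realType) (X : completeNormedModType R[i])
    (T Td : bop X X) (TTd : moore_penrose T Td) :
  [<-> (* (i) *) EP T;

       (* (ii) *)
       (exists (X1 X2 : completeNormedModType R[i]) (A1 B1 : bop X1 X1)
          (V1 W1 : bop (X1 \oplus1 X2) X) (S1 : bop X (X1 \oplus1 X2)),
          [/\ injective A1, injective V1,
              T = V1 \oL oplus0 X2 A1 \oL S1 &
              Td = W1 \oL oplus0 X2 B1 \oL S1]) /\
       (exists (X3 X4 : completeNormedModType R[i]) (A2 B2 : bop X3 X3)
          (V2 W2 : bop (X3 \oplus1 X4) X) (S2 : bop X (X3 \oplus1 X4)),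
          [/\ injective B2, injective W2,
              T = V2 \oL oplus0 X4 A2 \oL S2 &
              Td = W2 \oL oplus0 X4 B2 \oL S2]);

       (* (iii) *)
       (exists (Y1 Y2 : completeNormedModType R[i]) (A3 B3 : bop Y1 Y1)
          (V3 : bop (Y1 \oplus1 Y2) X) (S3 S4 : bop X (Y1 \oplus1 Y2)),
          [/\ set_surj setT setT A3, set_surj setT setT S3,
              T = V3 \oL oplus0 Y2 A3 \oL S3 &
              Td = V3 \oL oplus0 Y2 B3 \oL S4]) /\
       (exists (Y3 Y4 : completeNormedModType R[i]) (A4 B4 : bop Y3 Y3)
          (V4 : bop (Y3 \oplus1 Y4) X) (S5 S6 : bop X (Y3 \oplus1 Y4)),
          [/\ set_surj setT setT B4, set_surj setT setT S6,
              T = V4 \oL oplus0 Y4 A4 \oL S5 &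
              Td = V4 \oL oplus0 Y4 B4 \oL S6])].
Proof.
have TdT := moore_penrose_sym TTd.
tfae=> [/(EP_commute TTd) TTdC|[]|[]].
- split; first exact: commuting_injective_factor.
  (* Part (b) is part (a) for the pair [Td], [T]. *)
  have [X3 [X4 [B2 [A2 [W2 [V2 [S2 [*]]]]]]]] :=
    commuting_injective_factor TdT (esym TTdC).
  by exists X3, X4, A2, B2, V2, W2, S2.
- move=> [X1 [X2 [A1 [B1 [V1 [W1 [S1 [A1i V1i TE TdE]]]]]]]].
  move=> [X3 [X4 [A2 [B2 [V2 [W2 [S2 [B2i W2i TE' TdE']]]]]]]].
  (* The passage from (ii) to (iii) goes through (i): each half of (ii) gives one inclusion between
     the kernels of [T] and [Td]. *)
  have /(EP_commute TTd) TTdC : EP T.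
    apply: (EP_ker TTd) => x; split.
      exact: (injective_factor_ker A1i V1i TE TdE).
    exact: (injective_factor_ker B2i W2i TdE' TE').
  split; first exact: commuting_surjective_factor.
  have [Y3 [Y4 [B4 [A4 [V4 [S6 [S5 [*]]]]]]]] :=
    commuting_surjective_factor TdT (esym TTdC).
  by exists Y3, Y4, A4, B4, V4, S5, S6.
- move=> [Y1 [Y2 [A3 [B3 [V3 [S3 [S4 [A3s S3s TE TdE]]]]]]]].
  move=> [Y3 [Y4 [A4 [B4 [V4 [S5 [S6 [B4s S6s TE' TdE']]]]]]]].
  apply: (EP_range TTd); apply/seteqP; split.
    exact: (surjective_factor_range B4s S6s TdE' TE').
  exact: (surjective_factor_range A3s S3s TE TdE).
Qed.
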